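(* Let $\mathcal{H}$ be a Hilbert space and let $\{T_i\}_{i=1}^m$ be a finite family of nonexpansive operators $T_i:\mathcal{H}\to\mathcal{H}$ with $C:=\bigcap_{i=1}^m \mathrm{Fix}(T_i)\neq\emptyset$. Let $\{x^k\}_{k\in\mathbb{N}}$ be a sequence generated by the ASI algorithm (defined in the context) from the family $\{T_i\}_{i=1}^m$ with step sizes $\{\lambda_k\}_{k\in\mathbb{N}}$, almost cyclic control $\{i_k\}_{k\in\mathbb{N}}$ and delay vectors $\{d^k\}_{k\in\mathbb{N}}$. Suppose there is $\tau\geq 0$ such that $\|d^k\|_\infty\leq\tau$ for all $k\in\mathbb{N}$. If there is $\varepsilon>0$ such that $$0<\varepsilon\leq\lambda_k\leq\frac{1}{2\tau+1+\varepsilon}\quad\text{for all }k\in\mathbb{N},$$ then $\{x^k\}_{k\in\mathbb{N}}$ converges weakly to a common fixed point of the family, i.e., there is $x^*\in C$ such that $x^k\rightharpoonup x^*$.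
   Context: $\mathbb{N}=\{1,2,\dots\}$ and $[m]:=\{1,\dots,m\}$. $\mathrm{Fix}(T):=\{x\in\mathcal{H}\mid T(x)=x\}$. An operator $T:\mathcal{H}\to\mathcal{H}$ is nonexpansive if $\|T(x)-T(y)\|\leq\|x-y\|$ for all $x,y\in\mathcal{H}$. Set $S_i:=\mathrm{Id}-T_i$ for $i\in[m]$. Almost cyclic control: a sequence $\{i_k\}_{k\in\mathbb{N}}$ is an almost cyclic control on $[m]$ if $i_k\in[m]$ for all $k$ and there is an integer $M\geq m$ such that for each $k\in\mathbb{N}$, $[m]\subseteq\{i_{k+1},i_{k+2},\dots,i_{k+M}\}$. Delays: $\{d^k\}_{k\in\mathbb{N}}$ is a sequence of vectors of nonnegative integers, $d^k\in\mathbb{Z}_{\geq0}^m$, and $\hat{x}^k:=x^{k-(d^k)_{i_k}}$, where $(d^k)_{i_k}$ is the $i_k$-th component of $d^k$. ASI algorithm: let $x^1\in\mathcal{H}$ be arbitrary, let $\lambda_k\in(0,1)$ for all $k\in\mathbb{N}$, and let $\{i_k\}_{k\in\mathbb{N}}$ be an almost cyclic control on $[m]$. For each $k\in\mathbb{N}$ set $$x^{k+1}:=\begin{cases}x^k,&\text{if }k\leq\sup_{j\in\mathbb{N}}\|d^j\|_\infty,\\ x^k-\lambda_k S_{i_k}(\hat{x}^k),&\text{otherwise.}\end{cases}$$ *)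

(* Defs.v *)
From HB Require Import structures.
From mathcomp Require Import all_boot all_order all_algebra.
From mathcomp Require Import all_classical all_reals all_analysis.
From mathcomp Require Import complex.
Import Order.TTheory GRing.Theory Num.Theory.
Import numFieldNormedType.Exports.

Set Implicit Arguments.
Unset Strict Implicit.
Unset Printing Implicit Defensive.

Local Open Scope classical_set_scope.
Local Open Scope ring_scope.

(* Hilbert spaces are real or complex: a scalar field K with an involution
   theta is either R with the identity or R[i] with complex conjugation.
   A Hilbert space over it is a completeNormedModType K together with a form
   dot : {dot H for theta} (linear in the first argument, theta-linear in the
   second, hermitian, positive definite) such that dot x x = `|x| ^+ 2.

   Norms take their values in K, and the order of K = R[i] is
   x <= y iff y - x is a nonnegative real. Hence 0 < a forces a : K to be a
   positive real number: step sizes and constants are declared in K, and being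
   real is part of the inequalities imposed on them. *)
Inductive real_or_complex (R : realType) :
    forall K : numFieldType, (K -> K) -> Prop :=
| real_scalars : @real_or_complex R R idfun
| complex_scalars : @real_or_complex R R[i] Num.conj.

Section Operators.
Context {K : numFieldType} {H : normedModType K}.

Definition Fix (T : H -> H) : set H := [set x | T x = x].

Definition nonexpansive (T : H -> H) : Prop :=
  forall x y, `|T x - T y| <= `|x - y|.

(* Convergence for the weak topology, the one induced by the dual of H; K^o is
   K seen as a module over itself. *)
Definition weakly_converges (x : nat -> H) (l : H) : Prop :=
  forall f : {linear H -> K^o}, continuous f -> f (x k) @[k --> \oo] --> f l.

End Operators.

(* Sequences are indexed by {1, 2, ...}: they are functions on nat whose value
   at 0 is never constrained nor used. The index set [m] is 'I_m. *)

Definition almost_cyclic (m : nat) (i : nat -> 'I_m) : Prop :=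
  exists2 M : nat, (m <= M)%N &
    forall k, (0 < k)%N ->
      forall j : 'I_m, exists2 l : nat, (1 <= l <= M)%N & i (k + l)%N = j.

Definition normoo (m : nat) (v : 'I_m -> nat) : nat := \max_(j < m) v j.

(* Valued in \bar R, so that it is +oo for unbounded delays. *)
Definition sup_delay (R : realType) (m : nat) (d : nat -> 'I_m -> nat) :
    \bar R :=
  ereal_sup [set (normoo (d j))%:R%:E | j in [set j | (0 < j)%N]].

Section ASI.
Context {K : numFieldType} {H : normedModType K}.

(* The truncated subtraction only matters when k <= d k (i k), in which case
   the iteration below does not use this value. *)
Definition delayed (m : nat) (i : nat -> 'I_m) (d : nat -> 'I_m -> nat)
    (x : nat -> H) (k : nat) : H :=
  x (k - d k (i k))%N.

Record ASI (R : realType) (m : nat) (T : 'I_m -> H -> H) (lambda : nat -> K)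
    (i : nat -> 'I_m) (d : nat -> 'I_m -> nat) (x : nat -> H) : Prop := {
  ASI_step : forall k, (0 < k)%N -> 0 < lambda k < 1;
  ASI_control : almost_cyclic i;
  ASI_rec : forall k, (0 < k)%N ->
    let S j y := y - T j y in
    x k.+1 = if (k%:R%:E <= sup_delay R d)%E then x k
             else x k - lambda k *: S (i k) (delayed i d x k)
}.

End ASI.

(* Main.v *)
Require Import Defs.
From HB Require Import structures.
From mathcomp Require Import all_boot all_order all_algebra.
From mathcomp Require Import all_classical all_reals all_analysis.
From mathcomp Require Import complex ring lra.
Import Order.TTheory GRing.Theory Num.Theory.
Import numFieldNormedType.Exports.

(** The error made by using a delayed point is a sum of at most D past steps,
where D <= tau bounds the delays.  For a common fixed point p and the step
u_k = x_k - x_(k+1), cocoercivity of Id - T and 2 <u, v> <= |u|^2 + |v|^2 give,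
for every k > D,
  |x_(k+1) - p|^2 + (1/lambda_k - 1 - D) |u_k|^2
    <= |x_k - p|^2 + sum of |u_l|^2 over k - D <= l < k,
and 1/lambda_k - 1 - D >= D + eps ([delayed_step]).  The excess D |u_k|^2 on
the left is exactly what D later right-hand sides will consume: adding to
|x_k - p|^2 the past D squared steps, with weights 1, ..., D, gives an energy
that loses at least eps |u_k|^2 at each iteration ([energy_decrease]).  Hence
u_k tends to 0, |x_k - p| converges for every common fixed point p
([dist_cvg]), and, because every index is activated within any M consecutive
iterations, x_k - T_j x_k tends to 0 for every j ([residual_cvg0]).

Weak convergence is then obtained from asymptotic centers, without weak
compactness.  The asymptotic center of a bounded sequence y is the minimizer c
of limsup |y_n - z|; it exists because the parallelogram identity makes
minimizing sequences Cauchy ([asymptotic_center_exists]).  If y_n - T y_n tends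
to 0 then T c is as good a center as c, so T c = c
([asymptotic_center_fixed]).  If y stays in a closed convex set, so does c,
because projecting onto the set decreases the distances to y
([asymptotic_center_in_convex]).  Let c be the center of x.  Any subsequence
has a center c' which is again a common fixed point; as |x_k - c| and
|x_k - c'| converge along the whole sequence, c is a center of the subsequence
too.  So no closed convex set avoiding c contains infinitely many x_k
([common_fixed_point_limit]), and applying this to half-spaces gives weak
convergence ([weakly_converges_convex]).

Real and complex Hilbert spaces are treated together through the real inner
product Re <x, y> and the R-valued norm; nothing but the real structure of the
space matters until the half-spaces are chosen. *)

Set Implicit Arguments.
Unset Strict Implicit.
Unset Printing Implicit Defensive.
Local Open Scope classical_set_scope.
Local Open Scope ring_scope.

(** * The scalar field as an extension of the reals *)

(** What the argument uses of a scalar field that is R or R[i]: it lets norms,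
step sizes and inner products be compared as elements of R. The scalar [rot]
is 1 or 'i, so that [re z] and [re (rot * z)] determine z. *)
Record real_structure (R : realType) (K : numFieldType) (theta : K -> K) := {
  emb : {rmorphism R -> K};
  re : {additive K -> R};
  rot : K;
  le_emb : forall a b, (emb a <= emb b) = (a <= b);
  re_embM : forall a z, re (emb a * z) = a * re z;
  re_conj : forall z, re (theta z) = re z;
  ge0_re : forall z, 0 <= z -> emb (re z) = z;
  norm_re_le : forall z, emb `|re z| <= `|z|;
  norm_le_re : forall z e,
    `|re z| <= e -> `|re (rot * z)| <= e -> `|z| <= emb (e *+ 2)
}.
Arguments emb {R K theta}.
Arguments re {R K theta}.
Arguments rot {R K theta}.

Lemma real_structureP (R : realType) (K : numFieldType) (theta : K -> K) :
  real_or_complex R theta -> inhabited (real_structure R theta).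
Proof.
case; constructor.
  apply: (@Build_real_structure R R idfun idfun idfun 1) => //= z e.
  by move=> ze _; rewrite mulr2n (le_trans ze)// lerDl (le_trans _ ze).
refine (@Build_real_structure R R[i] Num.conj
  (real_complex R : {rmorphism R -> R[i]})
  (@complex.Re R : {additive Rcomplex R -> R}) 'i%C _ _ _ _ _ _).
- by move=> a b; exact: lecR.
- by move=> a [b c] /=; rewrite mul0r subr0.
- by case.
- by move=> z z0; apply: RRe_real; exact: ger0_real.
- move=> [a b]; rewrite normc_def lecR /= -sqrtr_sqr ler_wsqrtr//.
  by rewrite lerDl sqr_ge0.
- move=> [a b] e /=; rewrite normc_def lecR /= mul0r mul1r sub0r normrN => ae be.
  have e0 : 0 <= e by exact: le_trans ae.
  rewrite -[leRHS]ger0_norm ?mulrn_wge0// -sqrtr_sqr ler_wsqrtr//.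
  rewrite -(real_normK (num_real a)) -(real_normK (num_real b)).
  have := lerXn2r 2 (normr_ge0 a) e0 ae; have := lerXn2r 2 (normr_ge0 b) e0 be.
  nra.
Qed.

(** * The real inner product and the R-valued norm *)

Section RealGeometry.
Context {R : realType} {K : numFieldType} {theta : K -> K}.
Context (st : real_structure R theta).
Context {H : completeNormedModType K} (dot : {dot H for theta}).
Hypothesis dot_norm : forall x : H, dot x x = `|x| ^+ 2.

Lemma embK : cancel (emb st) (re st).
Proof.
have re1 : re st 1 = 1.
  apply/eqP; rewrite -(fmorph_eq1 (emb st)); apply/eqP.
  by rewrite ge0_re ?ler01.
by move=> a; rewrite -[emb st a]mulr1 re_embM re1 mulr1.
Qed.

Lemma emb_ge0 a : (0 <= emb st a) = (0 <= a).
Proof. by rewrite -(rmorph0 (emb st)) le_emb. Qed.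

Lemma emb_gt0 a : (0 < emb st a) = (0 < a).
Proof. by rewrite !lt0r emb_ge0 fmorph_eq0. Qed.

Definition rdot (x y : H) : R := re st (dot x y).
Definition rnorm (x : H) : R := re st `|x|.

Lemma emb_rnorm x : emb st (rnorm x) = `|x|.
Proof. exact: ge0_re. Qed.

Lemma rnorm_ge0 x : 0 <= rnorm x.
Proof. by rewrite -emb_ge0 emb_rnorm. Qed.

Lemma rnorm_le x y : (rnorm x <= rnorm y) = (`|x| <= `|y|).
Proof. by rewrite -(le_emb st) !emb_rnorm. Qed.

Lemma rnorm_le_emb x a : (rnorm x <= a) = (`|x| <= emb st a).
Proof. by rewrite -(le_emb st) emb_rnorm. Qed.

Lemma rnormD x y : rnorm (x + y) <= rnorm x + rnorm y.
Proof. by rewrite rnorm_le_emb rmorphD/= !emb_rnorm ler_normD. Qed.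

Lemma rnormN x : rnorm (- x) = rnorm x.
Proof. by rewrite /rnorm normrN. Qed.

Lemma rdistC x y : rnorm (x - y) = rnorm (y - x).
Proof. by rewrite /rnorm distrC. Qed.

Lemma rdistD z x y : rnorm (x - y) <= rnorm (x - z) + rnorm (z - y).
Proof. by rewrite -(subrKA z) rnormD. Qed.

Lemma rnorm0 : rnorm 0 = 0.
Proof. by rewrite /rnorm normr0 raddf0. Qed.

Lemma rnorm_eq0 x : rnorm x = 0 -> x = 0.
Proof. by move=> x0; apply/normr0_eq0; rewrite -emb_rnorm x0 rmorph0. Qed.

Lemma rnormZ a x : rnorm (emb st a *: x) = `|a| * rnorm x.
Proof.
wlog a0 : a / 0 <= a.
  move=> h; have [/h//|/ltW a0] := leP 0 a.
  by rewrite -rnormN -scaleNr -rmorphN h ?oppr_ge0// normrN.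
by rewrite /rnorm normrZ ger0_norm ?emb_ge0// re_embM ger0_norm.
Qed.

Lemma rdotC x y : rdot x y = rdot y x.
Proof. by rewrite /rdot [dot x y]hermitian_subproof expr0 mul1r re_conj. Qed.

Lemma rdotDl z x y : rdot (x + y) z = rdot x z + rdot y z.
Proof. by rewrite /rdot linearDl raddfD. Qed.

Lemma rdotNl x y : rdot (- x) y = - rdot x y.
Proof. by rewrite /rdot linearNl raddfN. Qed.

Lemma rdotZl a x y : rdot (emb st a *: x) y = a * rdot x y.
Proof. by rewrite /rdot linearZl/= re_embM. Qed.

Lemma rdotDr z x y : rdot z (x + y) = rdot z x + rdot z y.
Proof. by rewrite rdotC rdotDl !(rdotC z). Qed.

Lemma rdotNr x y : rdot y (- x) = - rdot y x.
Proof. by rewrite rdotC rdotNl rdotC. Qed.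

Lemma rdotZr a x y : rdot y (emb st a *: x) = a * rdot y x.
Proof. by rewrite rdotC rdotZl rdotC. Qed.

Lemma rdot_sumr (I : Type) (r : seq I) u (F : I -> H) :
  rdot u (\sum_(l <- r) F l) = \sum_(l <- r) rdot u (F l).
Proof.
by apply: big_morph => [a b|]; rewrite ?rdotDr// /rdot linear0r raddf0.
Qed.

Lemma rdotxx x : rdot x x = rnorm x ^+ 2.
Proof. by rewrite /rdot dot_norm -emb_rnorm -rmorphXn embK. Qed.

Definition rdotE := (rdotDl, rdotDr, rdotNl, rdotNr, rdotZl, rdotZr).

(** The parallelogram identity, read as uniform convexity: the
midpoint of two distinct points is strictly closer to z than the farther one. *)
Lemma dist_midpoint_sqr x y z :
  rnorm (z - (x + emb st 2^-1 *: (y - x))) ^+ 2 =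
  (rnorm (z - x) ^+ 2 + rnorm (z - y) ^+ 2) / 2 - rnorm (x - y) ^+ 2 / 4.
Proof.
rewrite -!rdotxx !rdotE (rdotC y x) (rdotC z x) (rdotC z y); lra.
Qed.

Lemma rdot_le_sqr x y : 2 * rdot x y <= rnorm x ^+ 2 + rnorm y ^+ 2.
Proof.
have := sqr_ge0 (rnorm (x - y)); rewrite -!rdotxx !rdotE (rdotC y x); lra.
Qed.

Lemma cvg_rnorm (u : nat -> H) l : u @ \oo --> l <->
  (forall e, 0 < e -> \forall n \near \oo, rnorm (l - u n) <= e).
Proof.
split=> [/cvgrPdist_le ul e e0|ul].
  have := ul (emb st e); rewrite emb_gt0 => /(_ e0).
  by apply: filterS => n; rewrite rnorm_le_emb.
apply/cvgrPdist_le => e e0.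
have := ul (re st e); rewrite -emb_gt0 ge0_re ?ltW// => /(_ e0).
by apply: filterS => n; rewrite rnorm_le_emb ge0_re // ltW.
Qed.

Lemma rnorm_cauchy (u : nat -> H) :
  (forall e, 0 < e -> exists N, forall n, (N <= n)%N -> rnorm (u N - u n) < e) ->
  cvgn u.
Proof.
move=> uC; apply: cauchy_cvg; apply: cauchy_exP => e e0.
have ee : emb st (re st e) = e by rewrite ge0_re// ltW.
have [|N uN] := uC (re st e); first by rewrite -emb_gt0 ee.
exists (u N); exists N => // n /= Nn; rewrite -ball_normE /ball_/=.
rewrite -ee -emb_rnorm lt_neqAle le_emb ltW ?uN// andbT.
by apply/eqP => /(fmorph_inj (emb st)) une; have := uN n Nn; rewrite une ltxx.
Qed.

(** * Asymptotic centers *)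

Definition eventually_within (y : nat -> H) (z : H) (r : R) :=
  \forall n \near \oo, rnorm (y n - z) <= r.

Definition convex_set (D : set H) := forall x y t, D x -> D y ->
  0 <= t <= 1 -> D (x + emb st t *: (y - x)).

(** rho is the least value of the limsup of |y_n - z| for z in D, and c
achieves it; the limsup is replaced by the bounds that hold eventually. *)
Record asymptotic_center (y : nat -> H) (D : set H) (c : H) (rho : R) := {
  center_mem : D c;
  center_within : forall r, rho < r -> eventually_within y c r;
  center_min : forall z r, D z -> eventually_within y z r -> rho <= r
}.

Lemma eventually_within_ge0 y z r : eventually_within y z r -> 0 <= r.
Proof. by case=> n _ /(_ n (leqnn n)); apply: le_trans (rnorm_ge0 _). Qed.

Lemma eventually_within_sqrt y z s :
  (\forall n \near \oo, rnorm (y n - z) ^+ 2 <= s) ->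
  eventually_within y z (Num.sqrt s).
Proof.
apply: filterS => n ys.
by rewrite -[leLHS]ger0_norm ?rnorm_ge0// -sqrtr_sqr ler_wsqrtr.
Qed.

(** The minimality of an asymptotic radius in a form suited to the quadratic
identities of the inner product. *)
Lemma asymptotic_radius_sqr (rho : R) y z s :
  0 <= rho -> (forall r, eventually_within y z r -> rho <= r) ->
  (\forall n \near \oo, rnorm (y n - z) ^+ 2 <= s) -> rho ^+ 2 <= s.
Proof.
move=> rho0 minrho ys.
have s0 : 0 <= s by case: ys => n _ /(_ n (leqnn n)); apply: le_trans (sqr_ge0 _).
by rewrite -(sqr_sqrtr s0) lerXn2r ?nnegrE ?sqrtr_ge0//; exact/minrho/eventually_within_sqrt.
Qed.

(** A minimizing sequence z of the limsup is Cauchy: the midpoint of z_p and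
z_n lies in D and would beat the infimum rho if z_p and z_n were far apart.
For a constant sequence y this is the projection onto D. *)
Lemma asymptotic_center_exists y (D : set H) z0 r0 :
  convex_set D -> closed D -> D z0 -> eventually_within y z0 r0 ->
  exists c rho, asymptotic_center y D c rho.
Proof.
move=> Dconv Dcl Dz0 yz0.
pose A := [set r | exists2 z, D z & eventually_within y z r].
pose rho := inf A.
have A0 : A !=set0 by exists r0, z0.
have lbA : lbound A 0 by move=> r [z _ /eventually_within_ge0].
have hA : has_inf A by split=> //; exists 0.
have rho0 : 0 <= rho by exact: lb_le_inf.
have minA z r : D z -> eventually_within y z r -> rho <= r.
  by move=> Dz yz; apply: ge_inf; [exists 0|exists z].
have exz n : exists z, D z /\ eventually_within y z (rho + n.+1%:R^-1).
  have n0 : 0 < n.+1%:R^-1 :> R by rewrite invr_gt0 ltr0n.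
  have [r [z Dz yz] /ltW rle] := inf_adherent n0 hA.
  by exists z; split => //; apply: filterS yz => k /le_trans; apply.
have [z /all_and2[Dz yz]] := choice exz.
(* with e = 1/(p+1), the midpoint gives |z_p - z_n|^2/4 <= (rho+e)^2 - rho^2
   and the right-hand side is at most e (2 rho + 1) *)
have zd p n : (p <= n)%N ->
    rnorm (z p - z n) ^+ 2 <= 4 * p.+1%:R^-1 * (2 * rho + 1).
  move=> pn; set e := p.+1%:R^-1.
  have e01 : 0 < e <= 1 by rewrite invr_gt0 ltr0n invf_le1 ?ler1n.
  have ne : n.+1%:R^-1 <= e by rewrite lef_pV2 ?posrE ?ltr0n// ler_nat.
  have Dmid : D (z p + emb st 2^-1 *: (z n - z p)) by apply: Dconv => //; lra.
  have : rho ^+ 2 <= (rho + e) ^+ 2 - rnorm (z p - z n) ^+ 2 / 4.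
    apply: (asymptotic_radius_sqr rho0 (fun r => minA _ r Dmid)).
    near=> k; rewrite dist_midpoint_sqr.
    have ykp : rnorm (y k - z p) <= rho + e by near: k; exact: yz.
    have ykn : rnorm (y k - z n) <= rho + e.
      by rewrite (@le_trans _ _ (rho + n.+1%:R^-1)) ?lerD2l//; near: k; exact: yz.
    have := lerXn2r 2 (rnorm_ge0 _) _ ykp.
    have := lerXn2r 2 (rnorm_ge0 _) _ ykn.
    rewrite !nnegrE; lra.
  nra.
have zcvg : cvgn z.
  apply: rnorm_cauchy => e e0.
  have e2 : 0 < e ^+ 2 / (4 * (2 * rho + 1)).
    by rewrite divr_gt0 ?exprn_gt0//; lra.
  have [N _ /(_ N (leqnn N)) Ne] := near_infty_natSinv_lt (PosNum e2).
  exists N => n /zd zNn; rewrite -[ltRHS]ger0_norm ?ltW// -[ltLHS]ger0_norm ?rnorm_ge0//.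
  rewrite -ltr_sqr ?nnegrE ?normr_ge0// !real_normK ?num_real//.
  apply: le_lt_trans zNn _; rewrite mulrAC -ltr_pdivlMl//; last by lra.
  by rewrite mulrC.
exists (limn z), rho; split => //.
- by apply: (@closed_cvg _ _ \oo _ z D) => //; exact: nearW.
- move=> r rhor; have e0 : 0 < (r - rho) / 2 by lra.
  have /cvg_rnorm/(_ _ e0) zl := zcvg.
  near \oo => n.
  have n1 : rnorm (limn z - z n) <= (r - rho) / 2 by near: n.
  have n2 : n.+1%:R^-1 < (r - rho) / 2.
    by near: n; exact: near_infty_natSinv_lt (PosNum e0).
  apply: filterS (yz n) => k yk.
  apply: le_trans (rdistD (z n) _ _) _; rewrite (rdistC (z n)).
  by rewrite (le_trans (lerD yk n1))//; move: n2; set e := _.+1%:R^-1; lra.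
Unshelve. all: by end_near. Qed.

Lemma asymptotic_center_ge0 y D c rho : asymptotic_center y D c rho -> 0 <= rho.
Proof.
move=> [_ yc _]; apply/ler_addgt0Pl => e e0.
by apply: (@eventually_within_ge0 y c); apply: yc; lra.
Qed.

(** Nonexpansiveness makes the limsup at T c at most the one at c, so the
midpoint of c and T c would be strictly better unless they coincide. *)
Lemma asymptotic_center_fixed y c rho (T : H -> H) :
  asymptotic_center y setT c rho -> (forall u v, `|T u - T v| <= `|u - v|) ->
  rnorm (y n - T (y n)) @[n --> \oo] --> 0 -> T c = c.
Proof.
move=> yc Tne yT; have rho0 := asymptotic_center_ge0 yc.
suff : rnorm (T c - c) ^+ 2 <= 0.
  move=> Tc; have /rnorm_eq0/eqP : rnorm (T c - c) = 0.
    by apply/eqP; rewrite -sqrf_eq0 eq_le Tc sqr_ge0.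
  by rewrite subr_eq0 => /eqP.
apply/ler_addgt0Pl => e e0; rewrite addr0.
(* t is chosen so that 4 ((rho+t)^2 - rho^2) <= e *)
pose t := Num.min 1 (e / (8 * (2 * rho + 1))).
have t0 : 0 < t by rewrite lt_min ltr01 divr_gt0//; lra.
have t1 : t <= 1 by rewrite ge_min lexx.
have te : t * (8 * (2 * rho + 1)) <= e.
  by rewrite -ler_pdivlMr ?ge_min ?lexx ?orbT//; lra.
have : rho ^+ 2 <= (rho + t) ^+ 2 - rnorm (T c - c) ^+ 2 / 4.
  apply: (asymptotic_radius_sqr rho0 (fun r => center_min yc
    (I : setT (T c + emb st 2^-1 *: (c - T c))))).
  near=> n; rewrite dist_midpoint_sqr.
  have yn : rnorm (y n - c) <= rho + t / 2.
    by near: n; apply: center_within yc _ _; lra.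
  have yTn : rnorm (y n - T (y n)) <= t / 2.
    rewrite -[leLHS]ger0_norm ?rnorm_ge0// -normrN -sub0r.
    by near: n; move/cvgrPdist_le : yT; apply; lra.
  have yTc : rnorm (y n - T c) <= rho + t.
    apply: le_trans (rdistD (T (y n)) _ _) _.
    have := Tne (y n) c; rewrite -rnorm_le; lra.
  have := lerXn2r 2 (rnorm_ge0 _) _ yTc.
  have {}yn : rnorm (y n - c) <= rho + t by lra.
  have := lerXn2r 2 (rnorm_ge0 _) _ yn.
  rewrite !nnegrE; lra.
nra.
Unshelve. all: by end_near. Qed.

(** Let p be the projection of c on D. Since y stays in D, the angle at p
between c and y_n is obtuse, so |y_n - p|^2 <= |y_n - c|^2 - |c - p|^2: moving
from c to p would decrease the limsup if p were not c. *)
Lemma asymptotic_center_in_convex y c rho D :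
  asymptotic_center y setT c rho -> convex_set D -> closed D ->
  (forall n, D (y n)) -> D c.
Proof.
move=> yc Dconv Dcl Dy; have rho0 := asymptotic_center_ge0 yc.
have cy0 : eventually_within (fun=> c) (y 0) (rnorm (c - y 0)) by exact: nearW.
have [p [d [Dp cp dmin]]] := asymptotic_center_exists Dconv Dcl (Dy 0) cy0.
have cpd : rnorm (c - p) <= d.
  apply/ler_addgt0Pl => e e0; have /cp[n _ /(_ n (leqnn n))//] : d < e + d by lra.
have proj z : D z -> rnorm (c - p) <= rnorm (c - z).
  by move=> Dz; apply: le_trans cpd (dmin _ _ Dz _); exact: nearW.
(* otherwise a small displacement from p towards z would get closer to c; with
   a the inner product, a/b <= 1 is small enough because |z - p|^2 <= b *)
have obtuse z : D z -> rdot (c - p) (z - p) <= 0.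
  move=> Dz; rewrite leNgt; apply/negP => a0.
  set a := rdot _ _ in a0; pose b := rnorm (z - p) ^+ 2 + a.
  have b0 : 0 < b by rewrite ltr_wpDl// sqr_ge0.
  have ab0 : 0 < a / b by rewrite divr_gt0.
  have ab1 : a / b <= 1 by rewrite ler_pdivrMr// mul1r lerDr sqr_ge0.
  have /proj : D (p + emb st (a / b) *: (z - p)).
    by apply: Dconv => //; rewrite ltW.
  rewrite -(@ler_pXn2r _ 2)// ?nnegrE ?rnorm_ge0//.
  rewrite opprD addrA -!rdotxx.
  move: (c - p) (z - p) @a @b ab0 ab1 a0 b0 => v w a b ab0 ab1 a0 b0.
  rewrite !rdotE (rdotC w v) -/a !rdotxx.
  have : a / b * rnorm w ^+ 2 <= a.
    by rewrite mulrAC ler_pdivrMr// /b -/w; nra.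
  nra.
have near_p s : rho ^+ 2 < s ->
    \forall n \near \oo, rnorm (y n - p) ^+ 2 <= s - rnorm (c - p) ^+ 2.
  move=> rs; have s0 : 0 <= s by apply: le_trans (sqr_ge0 _) (ltW rs).
  have : rho < Num.sqrt s.
    by rewrite -[ltLHS]ger0_norm// -sqrtr_sqr ltr_sqrt// (le_lt_trans (sqr_ge0 _) rs).
  move=> /(center_within yc); apply: filterS => n.
  move=> /(lerXn2r 2 (rnorm_ge0 _) (sqrtr_ge0 _)); rewrite sqr_sqrtr//.
  have := obtuse _ (Dy n).
  rewrite -[y n - c](subrKA p) -[p - c]opprB -!rdotxx !rdotE.
  rewrite !(rdotC c) !(rdotC (y n) p); lra.
suff : rnorm (c - p) = 0 by move=> /rnorm_eq0/eqP; rewrite subr_eq0 => /eqP ->.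
apply/eqP; rewrite -sqrf_eq0 eq_le sqr_ge0 andbT; apply/ler_addgt0Pl => e e0.
have : rho ^+ 2 <= rho ^+ 2 + e - rnorm (c - p) ^+ 2.
  apply: (asymptotic_radius_sqr rho0 (fun r => center_min yc (I : setT p))).
  by apply: near_p; lra.
lra.
Qed.

(** * Weak convergence to an asymptotic center *)

(** The conclusion is weak convergence of x to c phrased with closed convex
sets. If D contained x_n for infinitely many n, the corresponding subsequence
would have c as asymptotic center, and c would lie in D. *)
Lemma common_fixed_point_limit (J : Type) (T : J -> H -> H) x p0 :
  (forall j u v, `|T j u - T j v| <= `|u - v|) ->
  (forall j, T j p0 = p0) ->
  (forall p, (forall j, T j p = p) -> cvgn (fun n => rnorm (x n - p))) ->
  (forall j, rnorm (x n - T j (x n)) @[n --> \oo] --> 0) ->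
  exists2 c, forall j, T j c = c &
    forall D, convex_set D -> closed D -> ~ D c -> \forall n \near \oo, ~ D (x n).
Proof.
move=> Tne Tp0 xcvg xT.
have near_sub (s : nat -> nat) : (forall n, n <= s n)%N ->
    forall P : set nat, (\forall n \near \oo, P n) -> \forall n \near \oo, P (s n).
  move=> sge P [N _ PN]; exists N => // n /= Nn; apply: PN => /=.
  exact: leq_trans (sge n).
have xwithin z : cvgn (fun n => rnorm (x n - z)) ->
    forall r : R, limn (fun n => rnorm (x n - z)) < r -> eventually_within x z r.
  by move=> xz r lr; exact: cvgr_le xz _ lr.
have lim_min (s : nat -> nat) z r : (forall n, n <= s n)%N ->
    cvgn (fun n => rnorm (x n - z)) -> eventually_within (x \o s) z r ->
    limn (fun n => rnorm (x n - z)) <= r.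
  move=> sge xz xsr; rewrite leNgt; apply/negP => /(cvgr_gt _ xz)/(near_sub _ sge) rx.
  near \oo => n; have : rnorm (x (s n) - z) <= r by near: n.
  by rewrite leNgt => /negP; apply; near: n.
have fixc (s : nat -> nat) : (forall n, n <= s n)%N ->
    exists c rho, asymptotic_center (x \o s) setT c rho /\ forall j, T j c = c.
  move=> sge; pose l := limn (fun n => rnorm (x n - p0)).
  have xp0 : eventually_within x p0 (l + 1) by apply: xwithin; [exact: xcvg|rewrite ltrDl].
  have xsp0 : eventually_within (x \o s) p0 (l + 1) by exact: near_sub xp0.
  have [//|c [rho sc]] := asymptotic_center_exists _ closedT (I : setT p0) xsp0.
  exists c, rho; split=> // j; apply: (asymptotic_center_fixed sc (Tne j)).
  apply/cvgrPdist_le => e e0; have /cvgrPdist_le/(_ e e0) := xT j.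
  exact: near_sub.
have [//|c [rho [xc Tc]]] := fixc id.
exists c => // D Dconv Dcl Dc; apply: contrapT => freq.
have exs N : exists n, (N <= n)%N /\ D (x n).
  apply: contrapT => /forallNP h; apply: freq; exists N => // n /= Nn Dn.
  by apply: (h n).
have [s /all_and2[sge Ds]] := choice exs.
have [//|c' [rho' [yc Tc']]] := fixc s.
apply: Dc; apply: (@asymptotic_center_in_convex (x \o s) _ rho') => //.
split => // [r rr|z r _]; last exact: center_min yc _ _ I.
have le_lim : limn (fun n => rnorm (x n - c)) <= rho'.
  (* lim |x - c| <= rho <= lim |x - c'| <= rho': the outer inequalities come from
     c and c' being centers of x and of its subsequence, the middle one from
     minimality of rho *)
  apply: (@le_trans _ _ rho).
    apply/ler_addgt0Pl => e e0; apply: (lim_min id) => //; first exact: xcvg.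
    by apply: center_within xc _ _; lra.
  apply: (@le_trans _ _ (limn (fun n => rnorm (x n - c')))).
    apply/ler_addgt0Pl => e e0; apply: (center_min xc (I : setT c')).
    by apply: xwithin; [exact: xcvg|lra].
  apply/ler_addgt0Pl => e e0; apply: (lim_min s) => //; first exact: xcvg.
  by apply: center_within yc _ _; lra.
have xr : eventually_within x c r by apply: xwithin; [exact: xcvg|exact: le_lt_trans rr].
exact: near_sub xr.
Unshelve. all: by end_near. Qed.

(** The half-spaces {z | re (b f z) >= re (b f c) + e} are closed and convex and
avoid c; the four scalars b = 1, -1, rot, -rot control the norm of
f (x n) - f c. *)
Lemma weakly_converges_convex (x : nat -> H) c :
  (forall D, convex_set D -> closed D -> ~ D c -> \forall n \near \oo, ~ D (x n)) ->
  weakly_converges x c.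
Proof.
move=> xD f fcont.
have half (b : K) (e : R) : 0 < e ->
    \forall n \near \oo, re st (b * (f (x n) - f c)) < e.
  move=> e0; pose g z := re st (b * f z).
  have gcont : continuous g.
    move=> z; apply/cvgrPdist_le => d d0.
    have /cvgrPdist_le/(_ (emb st d)) : (b * f w : K^o) @[w --> z] --> (b * f z : K^o).
      by apply: cvgMr; exact: fcont.
    rewrite emb_gt0 => /(_ d0); apply: filterS => w; rewrite -(le_emb st).
    by apply: le_trans; rewrite -raddfB norm_re_le.
  have := xD [set z | g c + e <= g z]; set D := [set z | _].
  have Dconv : convex_set D.
    move=> u v t Du Dv t01; rewrite /D/= /g linearD linearZ linearB /=.
    rewrite /GRing.scale/= mulrDr mulrCA raddfD re_embM mulrBr raddfB /=.
    rewrite -/(g u) -/(g v); rewrite /D/= in Du Dv; nra.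
  have Dcl : closed D.
    by apply: (@closed_comp _ _ g [set t | g c + e <= t]) => //; exact: closed_ge.
  move=> /(_ Dconv Dcl); have Dc : ~ D c by rewrite /D/=; apply/negP; rewrite -ltNge; lra.
  move=> /(_ Dc); apply: filterS => n /negP; rewrite -ltNge mulrBr raddfB /=.
  by rewrite /g; lra.
apply/cvgrPdist_le => e e0; pose d := re st e / 2.
have d0 : 0 < d by rewrite divr_gt0// -(emb_gt0) ge0_re// ltW.
have -> : e = emb st (d *+ 2) by rewrite -mulr_natr divfK// ge0_re// ltW.
near=> n; rewrite distrC.
apply: (@norm_le_re _ _ _ st (f (x n) - f c) d); rewrite ler_norml;
  apply/andP; split.
- rewrite lerNl -raddfN -mulN1r ltW//; near: n; exact: half.
- rewrite -[X in re _ X]mul1r ltW//; near: n; exact: half.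
- rewrite lerNl -raddfN -mulNr ltW//; near: n; exact: half.
- by rewrite ltW//; near: n; exact: half.
Unshelve. all: by end_near. Qed.

(** * The delayed iteration *)

Section DelayedIteration.
Context {J : Type} (T : J -> H -> H) (x : nat -> H) (i : nat -> J).
Context (lam : nat -> R) (delay : nat -> nat) (D : nat) (eps : R).
Hypothesis T_ne : forall j u v, `|T j u - T j v| <= `|u - v|.
Hypothesis eps_gt0 : 0 < eps.
Hypothesis lam_ge : forall k, (0 < k)%N -> eps <= lam k.
Hypothesis lam_le : forall k, (0 < k)%N -> (2 * D%:R + 1 + eps) * lam k <= 1.
Hypothesis delay_le : forall k, (D < k)%N -> (delay k <= D)%N.
Hypothesis x_rec : forall k, (D < k)%N ->
  let y := x (k - delay k)%N in x k.+1 = x k - emb st (lam k) *: (y - T (i k) y).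

Lemma residual_cocoercive j p y : T j p = p ->
  rnorm (y - T j y) ^+ 2 <= 2 * rdot (y - T j y) (y - p).
Proof.
move=> Tp; have := T_ne j y p; rewrite -rnorm_le Tp.
move=> /(lerXn2r 2 (rnorm_ge0 _) (rnorm_ge0 _)).
have -> : T j y - p = (y - p) - (y - T j y) by rewrite opprB [RHS]addrC subrKA.
rewrite -!rdotxx; move: (y - p) (y - T j y) => a b.
rewrite !rdotE (rdotC b a); lra.
Qed.

Definition step_sqr k := rnorm (x k - x k.+1) ^+ 2.

Lemma step_sqr_ge0 k : 0 <= step_sqr k. Proof. exact: sqr_ge0. Qed.

(** The delayed index is k = n + D. A squared step enters with weight D and
loses 1 at each later iteration. *)
Definition energy p n :=
  rnorm (x (n + D)%N - p) ^+ 2 + \sum_(l < D) l.+1%:R * step_sqr (n + l).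

(** The left coefficient D + eps is 1/lambda_k - 1 - D in the worst case: one D
is lost to the products of the current step with the past ones that separate
x_k from the delayed point. *)
Lemma delayed_step j p k : (D < k)%N -> i k = j -> T j p = p ->
  rnorm (x k.+1 - p) ^+ 2 + (D%:R + eps) * step_sqr k <=
  rnorm (x k - p) ^+ 2 + \sum_(l < D) step_sqr (k - D + l).
Proof.
move=> Dk ik Tp; have k0 : (0 < k)%N by exact: leq_ltn_trans Dk.
have := x_rec Dk; rewrite ik; set y := x (k - delay k)%N => /= xk.
set u := emb st (lam k) *: (y - T j y) in xk.
have uE : u = x k - x k.+1 by rewrite xk opprB addrC subrK.
have lam0 : 0 < lam k by rewrite (lt_le_trans eps_gt0) ?lam_ge.
have coco : rnorm u ^+ 2 <= 2 * lam k * rdot u (y - p).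
  rewrite /u rnormZ gtr0_norm// exprMn rdotZl.
  have := residual_cocoercive y Tp; move: (rdot _ _) (rnorm _ ^+ 2) => a b.
  nra.
clearbody u.
have drift : 2 * rdot u (y - x k) <=
    D%:R * step_sqr k + \sum_(l < D) step_sqr (k - D + l).
  have -> : y - x k = \sum_(k - delay k <= l < k) (x l - x l.+1).
    rewrite -[RHS]opprK -sumrN; under eq_bigr do rewrite opprB.
    by rewrite telescope_sumr ?leq_subr// opprB.
  rewrite rdot_sumr mulr_sumr.
  apply: (@le_trans _ _ (\sum_(k - D <= l < k) (step_sqr k + step_sqr l))).
    rewrite [leRHS](@big_cat_nat _ _ _ (k - delay k)) ?leq_subr ?leq_sub2l ?delay_le//=.
    rewrite ler_wpDl//.
      by apply: sumr_ge0 => l _; rewrite addr_ge0 ?step_sqr_ge0.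
    by apply: ler_sum => l _; rewrite {1}uE; exact: rdot_le_sqr.
  rewrite big_split/= sumr_const_nat subKn 1?ltnW// mulr_natl lerD2l.
  rewrite -{1}[(k - D)%N]add0n big_addn subKn 1?ltnW// big_mkord.
  by under eq_bigr do rewrite addnC.
have xkp : rnorm (x k.+1 - p) ^+ 2 =
    rnorm (x k - p) ^+ 2 - 2 * rdot u (y - p) + 2 * rdot u (y - x k) + rnorm u ^+ 2.
  have -> : x k.+1 - p = (y - p) - (y - x k) - u.
    by rewrite xk opprB [y - p + _]addrC subrKA addrAC.
  have -> : x k - p = (y - p) - (y - x k) by rewrite opprB [y - p + _]addrC subrKA.
  rewrite -!rdotxx; move: (y - p) (y - x k) => a b.
  by rewrite !rdotE (rdotC a u) (rdotC b u) (rdotC b a); lra.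
have {}coco : (2 * D%:R + 1 + eps) * rnorm u ^+ 2 <= 2 * rdot u (y - p).
  have r0 : 0 <= rdot u (y - p).
    by rewrite -(@pmulr_rge0 _ (2 * lam k)) ?mulr_gt0// (le_trans _ coco)// sqr_ge0.
  apply: le_trans (_ : (2 * D%:R + 1 + eps) * (2 * lam k * rdot u (y - p)) <= _).
    have D0 : 0 <= D%:R :> R by [].
    have c0 : 0 <= 2 * D%:R + 1 + eps by move: eps_gt0 D0; set a := D%:R; lra.
    exact: ler_wpM2l.
  by have := lam_le k0; set a := D%:R; nra.
move: drift coco; rewrite xkp /step_sqr -uE; set a := D%:R; lra.
Qed.

Lemma energy_ge0 p n : 0 <= energy p n.
Proof.
rewrite addr_ge0 ?sqr_ge0//; apply: sumr_ge0 => l _.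
by rewrite mulr_ge0 ?step_sqr_ge0.
Qed.

Lemma energy_decrease p n : (0 < n)%N -> (forall j, T j p = p) ->
  energy p n.+1 + eps * step_sqr (n + D) <= energy p n.
Proof.
move=> n0 Tp.
have Dn : (D < n + D)%N by rewrite -{1}[D]add0n ltn_add2r.
have := delayed_step Dn erefl (Tp _); rewrite addnK.
(* summation by parts of the weights *)
have shift : \sum_(l < D) l.+1%:R * step_sqr (n.+1 + l) + \sum_(l < D) step_sqr (n + l) =
    D%:R * step_sqr (n + D) + \sum_(l < D) l.+1%:R * step_sqr (n + l).
  elim: D => [|m IH]; first by rewrite !big_ord0 mul0r.
  rewrite !big_ord_recr/= addrACA IH addSnnS.
  by rewrite -[in RHS]natr1 -[m.+1%:R]natr1; ring.
rewrite /energy addSn; lra.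
Qed.

Lemma energy_cvg p : (forall j, T j p = p) -> cvgn (fun n => energy p n.+1).
Proof.
move=> Tp; apply: nonincreasing_is_cvgn.
  apply/nonincreasing_seqP => n.
  have := energy_decrease (ltn0Sn n) Tp.
  by have := mulr_ge0 (ltW eps_gt0) (step_sqr_ge0 (n.+1 + D)); lra.
by exists 0 => _ [n _ <-]; exact: energy_ge0.
Qed.

Lemma step_sqr_cvg0 p : (forall j, T j p = p) -> step_sqr n @[n --> \oo] --> 0.
Proof.
move=> Tp.
have gap : energy p n.+1 - energy p n.+2 @[n --> \oo] --> 0.
  rewrite -(subrr (limn (fun n => energy p n.+1))).
  apply: cvgB; first exact: energy_cvg.
  by rewrite (cvg_shiftS (fun n => energy p n.+1)); exact: energy_cvg.
have : step_sqr (n.+1 + D) @[n --> \oo] --> 0.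
  have : eps^-1 * (energy p n.+1 - energy p n.+2) @[n --> \oo] --> 0.
    by rewrite -[X in _ --> X](mulr0 eps^-1); apply: cvgMr.
  apply: squeeze_cvgr (cvg_cst 0); apply: nearW => n; rewrite step_sqr_ge0/=.
  by rewrite ler_pdivlMl//; have := energy_decrease (ltn0Sn n) Tp; lra.
under eq_cvg do rewrite addSnnS.
by rewrite (cvg_shiftn _ step_sqr).
Qed.

Lemma step_cvg0 p : (forall j, T j p = p) -> rnorm (x n - x n.+1) @[n --> \oo] --> 0.
Proof.
move=> /step_sqr_cvg0/(continuous_cvg _ (@sqrt_continuous R 0)).
rewrite sqrtr0 (_ : Num.sqrt \o step_sqr = fun n => rnorm (x n - x n.+1))//.
by apply/funext => n /=; rewrite sqrtr_sqr ger0_norm ?rnorm_ge0.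
Qed.

Lemma dist_cvg p : (forall j, T j p = p) -> cvgn (fun n => rnorm (x n - p)).
Proof.
move=> Tp.
have W0 : \sum_(l < D) l.+1%:R * step_sqr (n.+1 + l) @[n --> \oo] --> 0.
  rewrite [X in _ --> X](_ : 0 = \sum_(l < D) (0 : R)); last by rewrite big1.
  apply: cvg_big => [|l _]; first exact: add_continuous.
  rewrite -[X in _ --> X](mulr0 l.+1%:R); apply: cvgMr.
  have : step_sqr (n + l.+1) @[n --> \oo] --> 0.
    by rewrite (cvg_shiftn _ step_sqr); exact: step_sqr_cvg0 Tp.
  by under eq_cvg do rewrite -addSnnS.
have /(continuous_cvg _ (@sqrt_continuous R _)) :
    energy p n.+1 - \sum_(l < D) l.+1%:R * step_sqr (n.+1 + l) @[n --> \oo] -->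
    limn (fun n => energy p n.+1) - 0 by apply: cvgB => //; exact: energy_cvg.
set lim := Num.sqrt _ => xlim; apply/cvg_ex; exists lim.
rewrite -(cvg_shiftn D.+1); apply: cvg_trans xlim; apply: near_eq_cvg.
apply: nearW => n /=.
by rewrite /energy addrK sqrtr_sqr ger0_norm ?rnorm_ge0// addSnnS.
Qed.

Lemma drift_cvg0 p L e : (forall j, T j p = p) -> 0 < e ->
  \forall n \near \oo, forall l, (l <= L)%N -> rnorm (x n - x (n + l)%N) <= e.
Proof.
move=> Tp; elim: L e => [|L IH] e e0.
  by apply: nearW => n l; rewrite leqn0 => /eqP->; rewrite addn0 subrr rnorm0 ltW.
have e2 : 0 < e / 2 by lra.
have stepL : \forall n \near \oo, rnorm (x (n + L)%N - x (n + L).+1) <= e / 2.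
  have := step_cvg0 Tp; rewrite -(cvg_shiftn L) => /cvgrPdist_le/(_ _ e2).
  by apply: filterS => n; rewrite sub0r normrN ger0_norm ?rnorm_ge0.
have := IH _ e2 => {}IH; near=> n => l.
have xL : forall h, (h <= L)%N -> rnorm (x n - x (n + h)%N) <= e / 2 by near: n.
have xs : rnorm (x (n + L)%N - x (n + L).+1) <= e / 2 by near: n.
rewrite leq_eqVlt => /predU1P[->|lL]; last by rewrite (le_trans (xL l lL))//; lra.
apply: le_trans (rdistD (x (n + L)%N) _ _) _; rewrite addnS.
by rewrite [leRHS]splitr lerD ?xL.
Unshelve. all: by end_near. Qed.

(** After n + D the index j is active at some k within M iterations, and the
step taken there is at least eps times the residual at the delayed point
q = x_(k - delay k). Since q and x_(n + D) are at most D + M steps away from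
x_n, the residual at x_(n + D) is small as well. *)
Lemma residual_cvg0 p j (M : nat) : (forall j, T j p = p) ->
  (forall k, (0 < k)%N -> exists2 l, (1 <= l <= M)%N & i (k + l)%N = j) ->
  rnorm (x n - T j (x n)) @[n --> \oo] --> 0.
Proof.
move=> Tp control; rewrite -(cvg_shiftn D); apply/cvgrPdist_le => e e0.
have e8 : 0 < e / 8 by lra.
have ee2 : 0 < eps * (e / 2) by rewrite mulr_gt0//; lra.
have /cvgrPdist_le/(_ _ ee2)[N _ stepN] := step_cvg0 Tp.
near=> n; rewrite sub0r normrN ger0_norm ?rnorm_ge0//.
have Nn : (N <= n)%N by near: n; exact: nbhs_infty_ge.
have n0 : (0 < n + D)%N by rewrite addn_gt0; apply/orP; left; near: n; exact: nbhs_infty_gt.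
have [l /andP[l1 lM] il] := control _ n0.
set k := (n + D + l)%N in il; pose q := x (k - delay k)%N.
have Dk : (D < k)%N by rewrite /k -addnA addnCA -addn1 leq_add2l addn_gt0 l1 orbT.
have dD := delay_le Dk.
have near_n h : (h <= D + M)%N -> rnorm (x n - x (n + h)%N) <= e / 8.
  by move: h; near: n; exact: drift_cvg0 Tp e8.
have qn : rnorm (x n - q) <= e / 8.
  have -> : q = x (n + (D + l - delay k))%N.
    by rewrite /q addnBA ?addnA// (leq_trans dD) ?leq_addr.
  by apply: near_n; rewrite leq_subLR (leq_trans _ (leq_addl _ _))// leq_add2l.
have xn : rnorm (x n - x (n + D)%N) <= e / 8 by apply: near_n; rewrite leq_addr.
have Tq : rnorm (q - T j q) <= e / 2.
  rewrite -(ler_pM2l eps_gt0).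
  apply: (@le_trans _ _ (lam k * rnorm (q - T j q))).
    by rewrite ler_wpM2r ?rnorm_ge0// lam_ge// (leq_ltn_trans _ Dk).
  have lam0 : 0 < lam k by rewrite (lt_le_trans eps_gt0) ?lam_ge ?(leq_ltn_trans _ Dk).
  rewrite -[lam k]gtr0_norm// -rnormZ.
  have -> : emb st (lam k) *: (q - T j q) = x k - x k.+1.
    by have := x_rec Dk; rewrite il -/q /= => ->; rewrite opprB [RHS]addrC subrK.
  have /stepN/= : (N <= k)%N by rewrite /k -addnA (leq_trans Nn) ?leq_addr.
  by rewrite sub0r normrN ger0_norm ?rnorm_ge0.
have xq : rnorm (x (n + D)%N - q) <= e / 4.
  by have := rdistD (x n) (x (n + D)%N) q; rewrite (rdistC _ (x n)); lra.
have Tqx : rnorm (T j q - T j (x (n + D)%N)) <= e / 4.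
  by rewrite (le_trans _ xq)// (rdistC _ q) rnorm_le.
have := rdistD q (x (n + D)%N) (T j (x (n + D)%N)).
have := rdistD (T j q) q (T j (x (n + D)%N)).
lra.
Unshelve. all: by end_near. Qed.

End DelayedIteration.

End RealGeometry.

(** * Bounded delays and the theorem *)

Lemma sup_delay_attained (R : realType) (m : nat) (d : nat -> 'I_m -> nat) B :
  (forall k, (0 < k)%N -> (normoo (d k) <= B)%N) ->
  exists D : nat, [/\ sup_delay R d = D%:R%:E,
    forall k, (0 < k)%N -> (normoo (d k) <= D)%N &
    exists2 k, (0 < k)%N & normoo (d k) = D].
Proof.
move=> dB; pose P n := `[< exists2 k, (0 < k)%N & normoo (d k) = n >].
have exP : exists n, P n by exists (normoo (d 1)); apply/asboolP; exists 1%N.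
have PB n : P n -> (n <= B)%N by move=> /asboolP[k /dB + <-].
case: (ex_maxnP exP PB) => D /asboolP[k k0 kD] maxD.
have leD j : (0 < j)%N -> (normoo (d j) <= D)%N.
  by move=> j0; apply: maxD; apply/asboolP; exists j.
exists D; split=> //; last by exists k.
apply/eqP; rewrite eq_le; apply/andP; split.
  by apply: ge_ereal_sup => _ [j /= j0 <-]; rewrite lee_fin ler_nat leD.
by apply: ereal_sup_ubound; exists k; rewrite ?kD.
Qed.

Theorem theorem1 (R : realType) (K : numFieldType) (theta : K -> K)
    (scalars : real_or_complex R theta)
    (H : completeNormedModType K) (dot : {dot H for theta})
    (dot_norm : forall x : H, dot x x = `|x| ^+ 2)
    (m : nat) (T : 'I_m -> H -> H)
    (T_nonexpansive : forall j, nonexpansive (T j))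
    (C_neq0 : \bigcap_j Fix (T j) !=set0)
    (lambda : nat -> K) (i : nat -> 'I_m) (d : nat -> 'I_m -> nat)
    (x : nat -> H) (x_ASI : ASI R T lambda i d x)
    (tau : K) (tau_ge0 : 0 <= tau)
    (d_le_tau : forall k, (0 < k)%N -> (normoo (d k))%:R <= tau)
    (eps : K) (eps_gt0 : 0 < eps)
    (lambda_bounds : forall k, (0 < k)%N ->
      eps <= lambda k <= 1 / (2 * tau + 1 + eps)) :
  exists2 xstar : H, (\bigcap_j Fix (T j)) xstar & weakly_converges x xstar.
Proof.
have [st] := real_structureP scalars.
case: x_ASI => lambda01 [M _ control] rec.
have [p0 Cp0] := C_neq0.
have Tp0 j : T j p0 = p0 by exact: Cp0.
have embtau : emb st (re st tau) = tau by exact: ge0_re.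
have embeps : emb st (re st eps) = eps by rewrite ge0_re ?ltW.
have emblam k : (0 < k)%N -> emb st (re st (lambda k)) = lambda k.
  by move=> k0; rewrite ge0_re//; have /andP[/ltW] := lambda01 k k0.
have dB k : (0 < k)%N -> (normoo (d k) <= Num.bound (re st tau))%N.
  move=> /d_le_tau; rewrite -[X in _ <= X -> _]embtau -(rmorph_nat (emb st)) le_emb => dle.
  rewrite -(ler_nat R) (le_trans dle)//; apply/ltW/archi_boundP.
  by rewrite -(emb_ge0 st) embtau.
have [D [supD dD [k1 k1_gt0 kD]]] := sup_delay_attained R dB.
have Dtau : D%:R <= tau by rewrite -kD d_le_tau.
have eps0 : 0 < re st eps by rewrite -(emb_gt0 st) embeps.
have lam_ge k : (0 < k)%N -> re st eps <= re st (lambda k).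
  move=> k_gt0; rewrite -(le_emb st) embeps emblam//.
  by have /andP[] := lambda_bounds k k_gt0.
have lam_le k : (0 < k)%N -> (2 * D%:R + 1 + re st eps) * re st (lambda k) <= 1.
  move=> k_gt0; rewrite -(le_emb st) rmorph1 rmorphM !rmorphD/= rmorphM !rmorph1.
  rewrite !rmorph_nat embeps emblam//.
  have /andP[lamge] := lambda_bounds k k_gt0.
  rewrite ler_pdivlMr; last by rewrite ltr_wpDl// addr_ge0// mulr_ge0.
  apply: le_trans; rewrite mulrC; apply: ler_wpM2l.
    by apply: le_trans lamge; exact: ltW.
  by rewrite !lerD2r ler_wpM2l.
have delay_le k : (D < k)%N -> (d k (i k) <= D)%N.
  move=> Dk; apply: leq_trans (dD k (leq_ltn_trans _ Dk)) => //.
  exact: (leq_bigmax (F := d k)).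
have x_rec k : (D < k)%N -> let y := x (k - d k (i k))%N in
    x k.+1 = x k - emb st (re st (lambda k)) *: (y - T (i k) y).
  move=> Dk /=; have k_gt0 := leq_ltn_trans (leq0n D) Dk.
  by rewrite rec// supD lee_fin ler_nat leqNgt Dk/= emblam.
have [p Tp|j|c Tc xc] :=
    @common_fixed_point_limit _ _ _ st H dot dot_norm _ T x p0 T_nonexpansive Tp0.
- exact: (dist_cvg dot_norm T_nonexpansive eps0 lam_ge lam_le delay_le x_rec Tp).
- apply: (residual_cvg0 dot_norm T_nonexpansive eps0 lam_ge lam_le delay_le x_rec Tp0).
  by move=> k /control/(_ j); exact.
exists c; first by move=> j _; exact: Tc.
exact: weakly_converges_convex xc.
Qed.
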